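(* Let $X$ be a finite metric space with $n=\#X$ points, let $\sigma(X)=(\sigma_1,\ldots,\sigma_{n-1})$ be its $\operatorname{mst}$-spectrum, and let $\lambda>0$ be a real number with $\lambda\ge 2\operatorname{diam}X$. Then for every $k$ with $1\le k\le n-1$, $$ \sigma_k=\lambda-2\,d_{GH}(X,\lambda\Delta_{k+1}). $$
   Context: For a metric space, $|xy|$ denotes the distance between points $x$ and $y$, and $\#X$ is the cardinality of $X$. $d_{GH}$ denotes the Gromov--Hausdorff distance: $d_{GH}(X,Y)$ is the infimum of real numbers $r$ such that there exist a metric space $Z$ and subsets $X',Y'\subset Z$ isometric to $X$ and $Y$ respectively with Hausdorff distance $d_H(X',Y')\le r$. For $\lambda>0$, $\lambda\Delta_m$ denotes the metric space on $\{1,\ldots,m\}$ all of whose nonzero distances equal $\lambda$. Minimum spanning trees: for a finite metric space $X$, consider trees $G=(X,E)$ with vertex set exactly $X$; the length of an edge $e=vw$ is $|e|=|vw|$ and the length $|G|$ of $G$ is the sum of the lengths of its edges. A minimum spanning tree on $X$ is such a tree of the smallest possible length. $\operatorname{mst}$-spectrum: for a minimum spanning tree $G$ on $X$, let $\sigma(G)$ be the vector of the lengths of the edges of $G$, ordered descending (with multiplicity), so it has $\#X-1$ entries. This vector does not depend on the choice of the minimum spanning tree $G$, and it is called the $\operatorname{mst}$-spectrum $\sigma(X)=(\sigma_1,\ldots,\sigma_{n-1})$, $\sigma_1\ge\cdots\ge\sigma_{n-1}$, of $X$. *)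

(* Defs.v *)
From HB Require Import structures.
From mathcomp Require Import all_boot all_order all_algebra.
From mathcomp Require Import all_classical all_reals all_analysis.

Set Implicit Arguments.
Unset Strict Implicit.
Unset Printing Implicit Defensive.


Import Order.TTheory GRing.Theory Num.Theory.

Local Open Scope classical_set_scope.
Local Open Scope ring_scope.

#[short(type="finMetricType")]
HB.structure Definition FinMetric (R : numDomainType) :=
  { X of Metric R X & Finite X }.

(* The lambda-simplex on m points, with point set {0, ..., m - 1}. The proof of
   0 < lambda is a parameter of the type because the metric axioms need it. *)
Definition simplex (R : realType) (lambda : R) (lambda_gt0 : 0 < lambda)
  (m : nat) : Type := 'I_m.

Section Simplex.
Variables (R : realType) (lambda : R) (lambda_gt0 : 0 < lambda) (m : nat).
Local Notation T := (simplex lambda_gt0 m).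

HB.instance Definition _ := Choice.copy T 'I_m.

Definition simplex_dist (i j : T) : R := if i == j then 0 else lambda.

Fact simplex_distxx i : simplex_dist i i = 0.
Proof. by rewrite /simplex_dist eqxx. Qed.

Fact simplex_dist_eq0 i j : simplex_dist i j = 0 -> i = j.
Proof.
rewrite /simplex_dist; case: eqP => // _ l0.
by have := lt0r_neq0 lambda_gt0; rewrite {1}l0 eqxx.
Qed.

Fact simplex_dist_sym i j : simplex_dist i j = simplex_dist j i.
Proof. by rewrite /simplex_dist eq_sym. Qed.

Fact simplex_dist_triangle j i k :
  simplex_dist i k <= simplex_dist i j + simplex_dist j k.
Proof.
have l0 := ltW lambda_gt0; rewrite /simplex_dist.
case: (eqVneq i k) => [_|ik]; first by rewrite addr_ge0//; case: ifP.
case: (eqVneq i j) => [<-|_]; first by rewrite (negbTE ik) add0r.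
by rewrite lerDl; case: ifP.
Qed.

HB.instance Definition _ := isMetric.Build R T simplex_distxx simplex_dist_eq0
  simplex_dist_sym simplex_dist_triangle.

End Simplex.

Section GromovHausdorff.
Variable R : realType.

Definition diam (X : metricType R) : \bar R :=
  ereal_sup [set (mdist p.1 p.2)%:E | p in [set: X * X]].

Definition hausdorff_dist (Z : metricType R) (A B : set Z) : \bar R :=
  maxe (ereal_sup [set ereal_inf [set (mdist a b)%:E | b in B] | a in A])
       (ereal_sup [set ereal_inf [set (mdist a b)%:E | a in A] | b in B]).

Definition isometric_to (X Z : metricType R) (A : set Z) : Prop :=
  exists2 f : X -> Z, (forall x y, mdist (f x) (f y) = mdist x y) & range f = A.

Definition gh_dist (X Y : metricType R) : \bar R :=
  ereal_inf [set r%:E | r in [set r : R |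
    exists (Z : metricType R) (A B : set Z),
      [/\ isometric_to X A, isometric_to Y B &
          (hausdorff_dist A B <= r%:E)%E]]].

End GromovHausdorff.

Section MinimumSpanningTree.
Variables (R : realType) (X : finMetricType R).

Implicit Types E : {set {set X}}.

Definition adjacent E : rel X := fun x y => [set x; y]%SET \in E.

(* The vertex set is always all of X. A cycle of a simple graph has at least
   three vertices; the cyclic sequences [:: x; y] only go back and forth along
   an edge. *)
Definition is_tree E : Prop :=
  [/\ forall e, e \in E -> #|e| = 2%N,
      forall x y, connect (adjacent E) x y &
      forall c, ucycle (adjacent E) c -> (size c <= 2)%N].

Definition edge_length (e : {set X}) : R :=
  if enum e is [:: v; w] then mdist v w else 0.

Definition graph_length E : R := \sum_(e in E) edge_length e.

Definition is_mst E : Prop :=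
  is_tree E /\ forall E', is_tree E' -> graph_length E <= graph_length E'.

Definition spectrum E : seq R :=
  sort (fun a b => b <= a) [seq edge_length e | e <- enum E].

Lemma edge_length2 (v w : X) : v != w -> edge_length [set v; w]%SET = mdist v w.
Proof.
move=> vw; rewrite /edge_length.
have := cards2 v w; rewrite vw cardE.
have := mem_enum [set v; w]%SET; have := enum_uniq [set v; w]%SET.
case: (enum _) => [|a [|b [|? ?]]] //= /andP[]; rewrite inE => ab _ memE _.
have := memE a; have := memE b; rewrite !inE !eqxx orbT /= => /esym Hb /esym Ha.
case/orP: Ha ab => /eqP->; case/orP: Hb => /eqP-> //; rewrite ?eqxx//.
by move=> _; exact: metric_sym.
Qed.

(* The star centred at any point is a tree. *)
Lemma tree_exists (x0 : X) : exists E, is_tree E.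
Proof.
exists [set [set x0; y]%SET | y in [set~ x0]%SET]%SET; set E := (X in is_tree X).
have EP x y : adjacent E x y -> (x != y) && ((x == x0) || (y == x0)).
  move=> /imsetP[z]; rewrite !inE => zx0 xyz.
  have := cards2 x y; rewrite xyz cards2 eq_sym zx0.
  case: (x != y) => //= _.
  have : x0 \in [set x; y]%SET by rewrite xyz !inE eqxx.
  by rewrite !inE ![x0 == _]eq_sym.
have adjC x y : adjacent E x y = adjacent E y x by rewrite /adjacent finset.setUC.
have c0 y : connect (adjacent E) x0 y.
  have [->|yx0] := eqVneq y x0; first exact: connect0.
  by apply: connect1; apply/imsetP; exists y; rewrite ?inE.
split.
- by move=> e /imsetP[y]; rewrite !inE => yx0 ->; rewrite cards2 eq_sym yx0.
- move=> x y; apply: connect_trans (c0 y).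
  by rewrite (sym_connect_sym adjC).
- move=> [|x [|y [|z c]]] // /andP[/= /and3P[xy yz cyc]].
  rewrite !inE !negb_or => /andP[/and3P[xy' xz _] /andP[/andP[yz' yc] _]].
  have /andP[_ /orP[/eqP xE|/eqP yE]] := EP _ _ xy.
    have /andP[_ /orP[/eqP yE|/eqP zE]] := EP _ _ yz.
      by rewrite xE yE eqxx in xy'.
    by rewrite xE zE eqxx in xz.
  suff [w zw wy] : exists2 w, adjacent E z w & w != y.
    have /andP[_] := EP _ _ zw.
    by rewrite -yE [z == y]eq_sym (negbTE yz') (negbTE wy).
  case: c cyc yc => [|w c] /= /andP[zw _]; first by exists x.
  by rewrite inE negb_or eq_sym => /andP[wy _]; exists w.
Qed.

Lemma mst_exists (x0 : X) : exists E, is_mst E.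
Proof.
have [E0 treeE0] := tree_exists x0.
have /(@arg_minP _ _ _ E0 (fun E => `[< is_tree E >]) graph_length) :
  `[< is_tree E0 >] by exact/asboolP.
case=> E /asboolP treeE minE; exists E; split=> // E' treeE'.
by apply: minE; exact/asboolP.
Qed.

End MinimumSpanningTree.

(* Main.v *)
(* Write s = sigma_k. Suppose that X and the simplex embed isometrically at
   Hausdorff distance r < (lambda - s) / 2. Every point of X is then close to
   exactly one vertex, so X is partitioned into k + 1 nonempty classes at
   mutual distances > s. A connected graph has at least k edges between k + 1
   classes, whereas fewer than k edges of G are longer than s.
   Conversely, delete from G the edges of length >= s, at least k in number.
   This leaves at least k + 1 components, because G has at most n - 1 edges, and
   by the exchange argument distinct components are at distance >= s. Merging
   components into exactly k + 1 classes, glue X to the simplex by putting x at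
   distance (lambda - s) / 2 from the vertex of its class and (lambda + s) / 2
   from the others; since 2 diam X <= lambda, this is a metric. *)

Require Import Defs.
From HB Require Import structures.
From mathcomp Require Import all_boot all_order all_algebra.
From mathcomp Require Import all_classical all_reals all_analysis.
From mathcomp Require Import zify lra.

Set Implicit Arguments.
Unset Strict Implicit.
Unset Printing Implicit Defensive.

Import Order.TTheory GRing.Theory Num.Theory.

Local Open Scope ring_scope.

(* Without this, adjacent is the sequence predicate of MathComp-Analysis. *)
Local Notation adjacent := Defs.adjacent.

(** * Connectivity, contraction and edge exchange in finite graphs *)

Section Graphs.
Variables (R : realType) (X : finMetricType R).
Implicit Types (E F C G K : {set {set X}}) (e : {set X}).

Definition graph_connected E := forall x y, connect (adjacent E) x y.

Lemma set2_inj (T : finType) (x y u v : T) :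
  [set x; y]%SET = [set u; v]%SET -> (x = u /\ y = v) \/ (x = v /\ y = u).
Proof.
move=> E.
have /set2P xuv : x \in [set u; v]%SET by rewrite -E set21.
have /set2P yuv : y \in [set u; v]%SET by rewrite -E set22.
have /set2P uxy : u \in [set x; y]%SET by rewrite E set21.
have /set2P vxy : v \in [set x; y]%SET by rewrite E set22.
by case: xuv yuv uxy vxy => ? [] ? [] ? [] ?; subst; auto.
Qed.

Lemma adjacentC E x y : adjacent E x y = adjacent E y x.
Proof. by rewrite /adjacent finset.setUC. Qed.

Lemma connect_adjacentC E : connect_sym (adjacent E).
Proof. by apply: sym_connect_sym; exact: adjacentC. Qed.

Lemma connect_adjacentS E F x y : E \subset F ->
  connect (adjacent E) x y -> connect (adjacent F) x y.
Proof.
move=> EF; apply: connect_sub => u v uv; apply: connect1.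
exact: (fintype.subsetP EF).
Qed.

Lemma connect_const (T : Type) (f : X -> T) E x y :
  (forall u v, adjacent E u v -> f u = f v) ->
  connect (adjacent E) x y -> f x = f y.
Proof.
move=> fE /connectP[p]; elim: p x => [x _ ->//|z p IHp x /= /andP[xz zp] yE].
by rewrite (fE _ _ xz); exact: IHp.
Qed.

(* Identify the values of f at the two ends of each edge of C in turn: each
   edge costs at most one value. *)
Lemma contract (T : finType) (f : X -> T) C :
  exists g : X -> T, [/\ forall x y, f x = f y -> g x = g y,
    forall x y, adjacent C x y -> g x = g y &
    (#|[set f x | x in X]%SET| <= #|[set g x | x in X]%SET| + #|C|)%N].
Proof.
have [m] := ubnP #|C|; elim: m => // m IHm in C *; rewrite ltnS => Cm.
have [->|[e eC]] := set_0Vmem C.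
  exists f; split=> //; last by rewrite cards0 addn0.
  by move=> x y; rewrite /adjacent inE.
have [g [gf gC gcard]] : exists g : X -> T, [/\ forall x y, f x = f y -> g x = g y,
    forall x y, adjacent (C :\ e)%SET x y -> g x = g y &
    (#|[set f x | x in X]%SET| <= #|[set g x | x in X]%SET| + #|(C :\ e)%SET|)%N].
  by apply: IHm; rewrite (cardsD1 e) eC in Cm.
have Ce x y : adjacent C x y -> [set x; y]%SET = e \/ g x = g y.
  move=> xy; have [|xye] := eqVneq [set x; y]%SET e; first by left.
  by right; apply: gC; rewrite /adjacent !inE xye.
have cardC : #|C| = #|(C :\ e)%SET|.+1 by rewrite (cardsD1 e) eC.
have [/existsP[u /existsP[v /andP[/eqP eE guv]]]|/existsPn euv] :=
    boolP [exists u, exists v, (e == [set u; v]%SET) && (g u != g v)]; last first.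
  exists g; split=> //; last by rewrite cardC addnS leqW.
  move=> x y /Ce[xyE|//]; apply/eqP; have /existsPn/(_ y) := euv x.
  by rewrite xyE eqxx /= negbK.
exists (fun x => if g x == g v then g u else g x); split.
- by move=> x y /gf ->.
- move=> x y /Ce[|->//]; rewrite eE => /set2_inj[[-> ->]|[-> ->]];
    by rewrite (negbTE guv) eqxx.
- rewrite (leq_trans gcard)// cardC addnS -addSn leq_add2r.
  set A := (X in (_ <= #|pred_of_set X|.+1)%N).
  apply: (@leq_trans #|(g v |: A)%SET|); last by rewrite cardsU1; case: (_ \notin _).
  apply/subset_leq_card/fintype.subsetP => _ /imsetP[x _ ->].
  rewrite !inE; have [//|/= gxv] := eqVneq (g x) (g v).
  by apply/imsetP; exists x => //; rewrite (negbTE gxv).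
Qed.

(** Once the edges of [C] are contracted on top of [f], the resulting map is constant along every
    edge of [E], hence constant. Its single value and the loss of at most one value per edge of [C]
    give the bound. *)
Lemma connected_crossing (T : finType) (f : X -> T) E C : graph_connected E ->
  (forall x y, adjacent E x y -> f x != f y -> adjacent C x y) ->
  (#|[set f x | x in X]%SET| <= #|C|.+1)%N.
Proof.
move=> connE crossC; have [g [gf gC]] := contract f C.
move=> /leq_trans; apply; rewrite -addn1 addnC leq_add2l.
apply/card_le1_eqP => _ _ /imsetP[x _ ->] /imsetP[y _ ->].
apply: connect_const (connE y x) => u v uv.
have [/gf //|fuv] := eqVneq (f u) (f v).
by apply: gC; exact: crossC.
Qed.

Lemma connected_card E : graph_connected E -> (#|X| <= #|E|.+1)%N.
Proof.
move=> connE; rewrite -(card_imset _ (@inj_id X)).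
exact: connected_crossing connE _.
Qed.

(** Grown from [x0] one vertex at a time: each new vertex [v] is attached by an edge of [E] leaving
    the current set [A], so [m.+1] vertices cost at most [m] edges. *)
Lemma spanning_subgraph E (x0 : X) : graph_connected E ->
  exists F, [/\ F \subset E, graph_connected F & (#|F| < #|X|)%N].
Proof.
move=> connE.
have grow m : (m < #|X|)%N -> exists (A : {set X}) F, [/\ F \subset E,
    #|A| = m.+1, (#|F| <= m)%N &
    forall a, a \in A -> connect (adjacent F) x0 a].
  elim: m => [_|m IHm mX].
    exists [set x0]%SET, finset.set0; rewrite finset.sub0set cards1 cards0; split=> //.
    by move=> a /set1P ->; exact: connect0.
  have [A [F [FE Am Fm FA]]] := IHm (ltnW mX).
  have [/existsP[u /existsP[v /and3P[uv uA vA]]]|/existsPn noexit] :=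
      boolP [exists u, exists v, [&& adjacent E u v, u \in A & v \notin A]].
    exists (v |: A)%SET, ([set u; v]%SET |: F)%SET; split.
    - by rewrite finset.subUset FE finset.sub1set andbT.
    - by rewrite cardsU1 vA Am.
    - by rewrite cardsU1 (leq_trans (leq_add (leq_b1 _) Fm)).
    - move=> a; have FS : F \subset ([set u; v]%SET |: F)%SET.
        by rewrite finset.subsetUr.
      rewrite inE => /orP[/set1P ->|/FA]; last exact: connect_adjacentS.
      apply: connect_trans (connect_adjacentS FS (FA _ uA)) (connect1 _).
      by rewrite /adjacent !inE eqxx.
  (* If no edge leaves [A], membership in [A] is constant along edges, so connectedness makes [A]
     all of [X], against its cardinality. *)
  have memA u v : adjacent E u v -> (u \in A) = (v \in A).
    have half a b : adjacent E a b -> a \in A -> b \in A.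
      move=> ab aA; have /existsPn/(_ b) := noexit a.
      by rewrite ab aA /= negbK.
    by move=> uv; apply/idP/idP; apply: half => //; rewrite adjacentC.
  have [a aA] : exists a, a \in A by apply/card_gt0P; rewrite Am.
  have AT : A = [set: X]%SET.
    by apply/setP => x; rewrite inE -(connect_const memA (connE a x)).
  by move: mX; rewrite -Am AT cardsT ltnn.
have X0 : (0 < #|X|)%N by apply/card_gt0P; exists x0.
have [|A [F [FE AX FX FA]]] := grow #|X|.-1; first by rewrite prednK.
exists F; split=> //; last by rewrite -ltnS prednK// in FX.
have AT a : a \in A.
  suff -> : A = [set: X]%SET by rewrite inE.
  by apply/eqP; rewrite eqEcard finset.subsetT cardsT AX prednK /=.
move=> x y; apply: connect_trans (FA _ (AT y)).
by rewrite connect_adjacentC FA.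
Qed.

(** The component of [x] in [F] contains one of [u], [v] and that of [y] contains the other, so the
    edge [xy] links [u] to [v] just as [uv] linked [x] to [y]. *)
Lemma connect_exchange F (u v x y : X) :
  connect (adjacent ([set u; v]%SET |: F)%SET) x y ->
  ~~ connect (adjacent F) x y ->
  connect (adjacent ([set x; y]%SET |: F)%SET) u v.
Proof.
move=> xy nxy.
(* A new edge [uv] enlarges the component of [z] only if exactly one of its ends lies there. *)
have sep (z w : X) : connect (adjacent ([set u; v]%SET |: F)%SET) z w ->
    ~~ connect (adjacent F) z w ->
    connect (adjacent F) z u != connect (adjacent F) z v.
  move=> zw nzw; apply/negP => /eqP zuv; move/negP: nzw; apply.
  rewrite -(connect_const (f := connect (adjacent F) z) _ zw) ?connect0// => a b.
  rewrite /adjacent !inE => /orP[/eqP/set2_inj[[-> ->]|[-> ->]]//|ab].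
  by apply: (same_connect_r (connect_adjacentC F)); exact: connect1.
have xs := sep _ _ xy nxy.
have ys : connect (adjacent F) y u != connect (adjacent F) y v.
  by apply: (sep _ x); rewrite connect_adjacentC.
have FS : F \subset ([set x; y]%SET |: F)%SET by rewrite finset.subsetUr.
have xyS : connect (adjacent ([set x; y]%SET |: F)%SET) x y.
  by apply: connect1; rewrite /adjacent !inE eqxx.
have nboth z : connect (adjacent F) x z -> connect (adjacent F) y z -> False.
  move=> xz yz; move/negP: nxy; apply; apply: connect_trans xz _.
  by rewrite connect_adjacentC.
case: (boolP (connect _ x u)) xs => [xu|_].
  case: (boolP (connect _ y u)) ys => [/(nboth _ xu)//|_]; case yv: connect => // _ _.
  rewrite connect_adjacentC in xu; apply: connect_trans (connect_adjacentS FS xu) _.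
  exact: connect_trans xyS (connect_adjacentS FS yv).
case xv: connect => // _.
case: (boolP (connect _ y u)) ys => [yu _|_]; last by case: (boolP (connect _ y v)) => [/(nboth _ xv)|].
rewrite connect_adjacentC in xyS; rewrite connect_adjacentC in yu.
apply: connect_trans (connect_adjacentS FS yu) _.
exact: connect_trans xyS (connect_adjacentS FS xv).
Qed.

Lemma connectedD1 E x y : graph_connected E ->
  connect (adjacent (E :\ [set x; y])%SET) x y -> graph_connected (E :\ [set x; y])%SET.
Proof.
move=> connE xy a b; have /connect_sub := connE a b; apply => u v uv.
have [/set2_inj[[-> ->]|[-> ->]]//|uvxy] := eqVneq [set u; v]%SET [set x; y]%SET.
  by rewrite connect_adjacentC.
by apply: connect1; rewrite /adjacent !inE uvxy.
Qed.

(** The rest of the cycle leads from [y] back to [x]. It avoids the edge [xy] because [z :: c]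
    contains neither [x] nor [y]. *)
Lemma ucycle_connect E x y z (c : seq X) : ucycle (adjacent E) [:: x, y, z & c] ->
  connect (adjacent (E :\ [set x; y])%SET) x y.
Proof.
move=> /andP[cyc /= /and3P[xc yc uc]]; rewrite connect_adjacentC.
apply/connectP; exists (rcons (z :: c) x); last by rewrite last_rcons.
move: cyc; rewrite (cycle_path x) /= => /and3P[lx _ /andP[yz zc]].
have nx a b : a \in z :: c -> [set a; b]%SET != [set x; y]%SET.
  move=> ac; apply/eqP => /set2_inj[[ax _]|[ay _]].
    by move: xc; rewrite -ax inE ac orbT.
  by move: yc; rewrite -ay ac.
rewrite rcons_path /=.
have -> : adjacent (E :\ [set x; y])%SET (last z c) x.
  by rewrite /adjacent !inE nx ?mem_last.
have -> /= : adjacent (E :\ [set x; y])%SET y z.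
  by rewrite adjacentC /adjacent !inE nx ?mem_head//= finset.setUC.
rewrite andbT; apply: (sub_in_path (P := predC1 x)) zc; last first.
  by apply/allP => a ac; apply: contraNneq xc => <-; rewrite inE ac orbT.
move=> a b /= ax bx ab; rewrite /adjacent !inE [_ \in E]ab andbT.
apply/eqP => /set2_inj[[/eqP]|[_ /eqP]]; first by rewrite (negbTE ax).
by rewrite (negbTE bx).
Qed.

(** * Edge lengths and minimum spanning trees *)

Lemma edge_length_ge0 e : 0 <= edge_length e.
Proof.
by rewrite /edge_length; case: (enum e) => [|v [|w []]] //; exact: mdist_ge0.
Qed.

Lemma edge_length_gt0 e : #|e| = 2%N -> 0 < edge_length e.
Proof. by move=> /eqP/cards2P[v [w [vw ->]]]; rewrite edge_length2// mdist_gt0. Qed.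

Lemma graph_lengthD1 E e : e \in E ->
  graph_length E = edge_length e + graph_length (E :\ e)%SET.
Proof. exact: big_setD1. Qed.

(** Only an inequality, since [e] may already belong to [E]. *)
Lemma graph_lengthU1 E e :
  graph_length (e |: E)%SET <= edge_length e + graph_length E.
Proof.
have [eE|eE] := boolP (e \in E); last by rewrite /graph_length big_setU1.
by rewrite (finset.setUidPr _) ?finset.sub1set// lerDr edge_length_ge0.
Qed.

Lemma graph_lengthS E F : E \subset F -> graph_length E <= graph_length F.
Proof.
move=> /finset.setIidPr EF; rewrite /graph_length [leRHS](big_setID E) /= EF.
by rewrite lerDl sumr_ge0// => e _; exact: edge_length_ge0.
Qed.

(* A connected graph that is not a tree has a cycle, and deleting an edge of
   the cycle keeps it connected without making it longer. *)
Lemma mst_le_connected G E : is_mst G -> (forall e, e \in E -> #|e| = 2%N) ->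
  graph_connected E -> graph_length G <= graph_length E.
Proof.
move=> [treeG minG]; have [m] := ubnP #|E|; elim: m => // m IHm in E *.
rewrite ltnS => Em E2 connE.
have [acyc|] := pselect (forall c, ucycle (adjacent E) c -> (size c <= 2)%N).
  exact: minG.
move=> /existsNP[c /not_implyP[cyc /negP]]; rewrite -ltnNge => c2.
case: c c2 cyc => [|x [|y [|z c]]] // _ cyc.
have xyE : [set x; y]%SET \in E by case/andP: cyc => /andP[].
apply: (@le_trans _ _ (graph_length (E :\ [set x; y])%SET)); last first.
  exact/graph_lengthS/finset.subsetDl.
apply: IHm.
- by move: Em; rewrite (cardsD1 [set x; y]%SET) xyE.
- by move=> e /setD1P[_ /E2].
- exact: connectedD1 (ucycle_connect cyc).
Qed.

(** [G] contains a connected spanning subgraph [F] with fewer than [#|X|] edges. Edges have positive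
    length, so a proper [F] would be strictly shorter than [G], against minimality. *)
Lemma mst_card G (x0 : X) : is_mst G -> (#|G| < #|X|)%N.
Proof.
move=> mstG; have [[G2 connG _] _] := mstG.
have [F [FG connF FX]] := spanning_subgraph x0 connG.
suff -> : G = F by [].
apply/eqP; rewrite finset.eqEsubset FG andbT; apply/fintype.subsetP => e eG.
apply/negPn/negP => eF.
have := mst_le_connected mstG (fun e0 e0F => G2 e0 (fintype.subsetP FG e0 e0F)) connF.
apply/negP; rewrite -ltNge (graph_lengthD1 eG).
apply: (@le_lt_trans _ _ (graph_length (G :\ e)%SET)).
  by apply: graph_lengthS; rewrite finset.subsetD1 FG.
by rewrite ltrDr edge_length_gt0// G2.
Qed.

(** The edges of [K] are returned to the graph one by one. The edge whose return joins [x] to [y]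
    can be exchanged in [G] for [xy], so minimality makes it no longer than [mdist x y]. *)
Lemma mst_cut G K x y : is_mst G ->
  ~~ connect (adjacent (G :\: K)%SET) x y ->
  exists2 e, e \in K & edge_length e <= mdist x y.
Proof.
move=> mstG; have [[G2 connG _] _] := mstG.
have [m] := ubnP #|K|; elim: m => // m IHm in K *; rewrite ltnS => Km nxy.
have [K0|[e eK]] := set_0Vmem K; first by rewrite K0 finset.setD0 connG in nxy.
have [xy|nxy'] := boolP (connect (adjacent (G :\: (K :\ e))%SET) x y); last first.
  have [|e' /setD1P[_ e'K] e'xy] := IHm (K :\ e)%SET _ nxy'; last by exists e'.
  by move: Km; rewrite (cardsD1 e) eK.
(* Otherwise returning [e] would change nothing, and [x] and [y] would still be disconnected. *)
have eG : e \in G.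
  apply: contraNT nxy => eG; suff -> : (G :\: K = G :\: (K :\ e))%SET by [].
  apply/setP => a; rewrite !inE; have [->|//] := eqVneq a e.
  by rewrite (negbTE eG) !andbF.
exists e => //.
have /eqP/cards2P[u [v [uv eE]]] := G2 _ eG.
have GKe : (G :\: (K :\ e))%SET = (e |: (G :\: K))%SET.
  apply/setP => a; rewrite !inE; have [->|//] := eqVneq a e.
  by rewrite eG.
rewrite GKe eE in xy; have uvS := connect_exchange xy nxy.
have xneqy : x != y by apply: contraNneq nxy => ->; exact: connect0.
(* The competitor of [G]: the edge [e] is traded for [xy]. *)
pose H := ([set x; y] |: (G :\ e))%SET.
have connH : graph_connected H.
  move=> a b; have /connect_sub := connG a b; apply => c d cd.
  have HS : ([set x; y] |: (G :\: K))%SET \subset H.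
    by apply/finset.setUS/finset.setDS; rewrite finset.sub1set.
  have [cde|cde] := eqVneq [set c; d]%SET e.
    move: cde; rewrite eE => /set2_inj[[-> ->]|[-> ->]].
      exact: connect_adjacentS HS uvS.
    by rewrite connect_adjacentC; exact: connect_adjacentS HS uvS.
  by apply: connect1; rewrite /adjacent !inE cde [_ \in G]cd orbT.
have H2 a : a \in H -> #|a| = 2%N.
  by rewrite !inE => /orP[/eqP ->|/andP[_ /G2]//]; rewrite cards2 xneqy.
have := le_trans (mst_le_connected mstG H2 connH) (graph_lengthU1 _ _).
by rewrite (graph_lengthD1 eG) edge_length2// lerD2r.
Qed.

End Graphs.

(** * Counting the entries of a descending sequence above a given one *)

Section DescendingSequences.
Variable R : realType.
Implicit Types (s : seq R) (i : nat).

Let geR := fun a b : R => b <= a.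

Let geR_trans : transitive geR.
Proof. by move=> a b c ba cb; exact: le_trans cb ba. Qed.

Let geR_refl : reflexive geR.
Proof. by move=> a; exact: lexx. Qed.

(** The first [i.+1] entries all qualify; ties may add more. *)
Lemma descending_count_ge s i : sorted geR s -> (i < size s)%N ->
  (i < count (fun a => s`_i <= a)%R s)%N.
Proof.
move=> ss si; rewrite -[X in count _ X](cat_take_drop i.+1) count_cat.
have /eqP -> : count (fun a => s`_i <= a)%R (take i.+1 s) == size (take i.+1 s).
  rewrite -all_count; apply/(all_nthP 0) => j; rewrite size_takel// => ji.
  rewrite nth_take//; apply: (sorted_leq_nth geR_trans geR_refl) => //.
  by rewrite inE (leq_ltn_trans _ si).
by rewrite size_takel// leq_addr.
Qed.

Lemma descending_count_gt s i : sorted geR s -> (i < size s)%N ->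
  (count (fun a => s`_i < a)%R s <= i)%N.
Proof.
move=> ss si; rewrite -[X in count _ X](cat_take_drop i) count_cat.
have -> : count (fun a => s`_i < a)%R (drop i s) = 0%N.
  apply/eqP; rewrite -leqn0 leqNgt -has_count; apply/(has_nthP 0) => -[j].
  rewrite size_drop nth_drop ltn_subRL => js; apply/negP; rewrite -leNgt.
  by apply: (sorted_leq_nth geR_trans geR_refl) => //; exact: leq_addr.
by rewrite addn0 (leq_trans (count_size _ _))// size_takel// ltnW.
Qed.

End DescendingSequences.

(** * Separated partitions of [X] and the spectrum *)

Section Spectrum.
Variables (R : realType) (X : finMetricType R).
Implicit Types (G : {set {set X}}) (k : nat).

Lemma spectrum_sorted G : sorted (fun a b => b <= a) (spectrum G).
Proof. by apply: sort_sorted => a b; exact: le_total. Qed.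

Lemma size_spectrum G : size (spectrum G) = #|G|.
Proof. by rewrite size_sort size_map -cardE. Qed.

Lemma count_spectrum G (P : pred R) :
  count P (spectrum G) = #|[set e in G | P (edge_length e)]%SET|.
Proof.
rewrite /spectrum count_sort count_map -size_filter cardE; apply/perm_size/uniq_perm.
- by rewrite filter_uniq// enum_uniq.
- exact: enum_uniq.
- by move=> e; rewrite mem_filter mem_enum [RHS]mem_enum finset.in_set andbC.
Qed.

Lemma spectrum_mem G k : (k < #|G|)%N ->
  exists2 e, e \in G & (spectrum G)`_k = edge_length e.
Proof.
rewrite -size_spectrum => /(mem_nth 0); rewrite mem_sort => /mapP[e].
by rewrite mem_enum => eG ->; exists e.
Qed.

(** The classes come from contracting the edges shorter than [s]. At least [k.+1] edges of [G]
    remain uncontracted and [G] has fewer than [#|X|] edges, so at least [k.+2] classes are left;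
    [mst_cut] separates them. *)
Lemma mst_clustering G k : is_mst G -> (k < #|G|)%N ->
  exists f : X -> 'I_k.+2, (forall i, exists x, f x = i) /\
    forall x y, f x != f y -> (spectrum G)`_k <= mdist x y.
Proof.
move=> mstG kG; set s := (spectrum G)`_k.
have [x0] : inhabited X.
  have [e eG _] := spectrum_mem kG; have [[G2 _ _] _] := mstG.
  by have /eqP/cards2P[x _] := G2 _ eG; exists.
pose K := [set e in G | s <= edge_length e]%SET.
have Kk : (k < #|K|)%N.
  rewrite -count_spectrum; apply: descending_count_ge; first exact: spectrum_sorted.
  by rewrite size_spectrum.
have KG : K \subset G by apply/fintype.subsetP => e /setIdP[].
have [g [_ gGK gcard]] := contract id (G :\: K)%SET.
have {gcard} gk : (k.+2 <= #|[set g x | x in X]%SET|)%N.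
  have GX := mst_card x0 mstG; have KG' := subset_leq_card KG.
  rewrite card_imset// cardsD (finset.setIidPr KG) in gcard.
  have : (#|X| <= #|[set g x | x in X]%SET| + (#|G| - #|K|))%N by [].
  lia.
have gs x y : g x != g y -> s <= mdist x y.
  move=> gxy; have [|e /setIdP[_ se] /(le_trans se)//] := @mst_cut _ _ G K x y mstG.
  by apply: contra gxy => /(connect_const gGK) ->.
pose im := enum [set g x | x in X]%SET.
(* The classes are numbered by their position in [im], and all those from position [k.+1] on are
   merged into one. Merging only reduces the pairs that must be separated. *)
exists (fun x => inord (minn (index (g x) im) k.+1)); split=> [i|x y].
  have iim : (i < size im)%N by rewrite -cardE (leq_trans _ gk).
  have : nth x0 im i \in im by exact: mem_nth.
  rewrite mem_enum => /imsetP[x _ xE]; exists x.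
  by rewrite -xE index_uniq ?enum_uniq// (minn_idPl _) ?inord_val// -ltnS.
by move=> fxy; apply: gs; apply: contra fxy => /eqP ->.
Qed.

(** Every edge of [G] between two classes is longer than the entry of index [k], so there are at
    most [k] of them, too few to connect [k.+2] classes. *)
Lemma mst_no_clustering G k (f : X -> 'I_k.+2) : is_mst G -> (k < #|G|)%N ->
  (forall i, exists x, f x = i) ->
  (forall x y, f x != f y -> (spectrum G)`_k < mdist x y) -> False.
Proof.
move=> [[G2 connG _] _] kG fsurj fs.
pose C := [set e in G | (spectrum G)`_k < edge_length e]%SET.
have Ck : (#|C| <= k)%N.
  rewrite -count_spectrum; apply: descending_count_gt; first exact: spectrum_sorted.
  by rewrite size_spectrum.
have : (#|[set f x | x in X]%SET| <= #|C|.+1)%N.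
  apply: connected_crossing connG _ => x y xy fxy.
  rewrite /adjacent inE [_ \in G]xy edge_length2 ?fs//.
  by apply: contraNneq fxy => ->.
have -> : [set f x | x in X]%SET = [set: 'I_k.+2]%SET.
  apply/setP => i; rewrite !inE; have [x <-] := fsurj i.
  by apply/imsetP; exists x.
by rewrite cardsT card_ord ltnS ltnNge Ck.
Qed.

End Spectrum.

(** * Upper bound: gluing [X] to the simplex *)

Section Glue.
Variables (R : realType) (X : metricType R) (lambda sigma : R).
Variables (lambda_gt0 : 0 < lambda) (m : nat) (f : X -> simplex lambda_gt0 m).
Hypotheses (sigma_ge0 : 0 <= sigma) (sigma_lt : sigma < lambda).
Hypothesis mdist_le : forall x y : X, mdist x y <= lambda - sigma.
Hypothesis f_sep : forall x y, f x != f y -> sigma <= mdist x y.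

(* The hypotheses are parameters of the type because the metric axioms need
   them. *)
Definition glued (_ : 0 <= sigma) (_ : sigma < lambda)
    (_ : forall x y : X, mdist x y <= lambda - sigma)
    (_ : forall x y, f x != f y -> sigma <= mdist x y) : Type :=
  (X + simplex lambda_gt0 m)%type.

Local Notation T := (glued sigma_ge0 sigma_lt mdist_le f_sep).

HB.instance Definition _ := Choice.copy T (X + simplex lambda_gt0 m)%type.

(** The two values have sum [lambda], the distance between vertices, and difference [sigma], the
    least distance between classes. *)
Definition cross_dist (x : X) (i : simplex lambda_gt0 m) : R :=
  if f x == i then (lambda - sigma) / 2 else (lambda + sigma) / 2.

Definition glued_dist (p q : T) : R :=
  match p, q with
  | inl x, inl y => mdist x y
  | inr i, inr j => mdist i j
  | inl x, inr i | inr i, inl x => cross_dist x i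
  end.

Let cross_dist_gt0 x i : 0 < cross_dist x i.
Proof.
have [s0 sl] := conj sigma_ge0 sigma_lt.
by rewrite /cross_dist; case: ifP => _; lra.
Qed.

Fact glued_distxx p : glued_dist p p = 0.
Proof. by case: p => x; exact: mdistxx. Qed.

Fact glued_dist_eq0 p q : glued_dist p q = 0 -> p = q.
Proof.
case: p q => [x|i] [y|j] /=.
- by move/mdist_positivity ->.
- by move/eqP; rewrite gt_eqF.
- by move/eqP; rewrite gt_eqF.
- by move/mdist_positivity ->.
Qed.

Fact glued_dist_sym p q : glued_dist p q = glued_dist q p.
Proof. by case: p q => [x|i] [y|j] //=; exact: metric_sym. Qed.

Let simplexE (i j : simplex lambda_gt0 m) :
  mdist i j = if i == j then 0 else lambda.
Proof. by []. Qed.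

(** The critical cases: a detour between two points through a vertex costs at least
    [lambda - sigma], whence [mdist_le]; passing to a point of another class costs at least [sigma],
    by [f_sep]; a detour between two vertices through a point costs at least [lambda], since only
    one of them is the vertex of its class. *)
Fact glued_dist_triangle q p r :
  glued_dist p r <= glued_dist p q + glued_dist q r.
Proof.
have [s0 sl] := conj sigma_ge0 sigma_lt.
have cross2 x i y j : lambda - sigma <= cross_dist x i + cross_dist y j.
  by rewrite /cross_dist; case: ifP => _; case: ifP => _; lra.
have cross_tri x y i : cross_dist x i <= mdist x y + cross_dist y i.
  have d0 := mdist_ge0 x y; rewrite /cross_dist.
  case: (eqVneq (f y) i) => [<-|_]; last by case: ifP => _; lra.
  by case: (eqVneq (f x) (f y)) => [_|/f_sep sd]; lra.
case: p q r => [x|i] [y|j] [z|l] /=.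
- exact: metric_triangle.
- exact: cross_tri.
- exact: le_trans (mdist_le _ _) (cross2 _ _ _ _).
- rewrite simplexE /cross_dist; case: (eqVneq j l) => [->|jl]; first by rewrite addr0.
  by case: ifP => _; case: ifP => _; lra.
- by rewrite metric_sym addrC; exact: cross_tri.
- rewrite simplexE; case: (eqVneq i l) => [_|il].
    by rewrite addr_ge0// ltW.
  rewrite /cross_dist; case: (eqVneq (f y) i) => [->|_]; first rewrite (negbTE il); first lra.
  by case: ifP => _; lra.
- rewrite simplexE /cross_dist; case: (eqVneq i j) => [->|ij]; first by rewrite add0r.
  by case: ifP => _; case: ifP => _; lra.
- exact: metric_triangle.
Qed.

HB.instance Definition _ := isMetric.Build R T glued_distxx glued_dist_eq0
  glued_dist_sym glued_dist_triangle.

Lemma gh_dist_simplex_le : (forall i, exists x, f x = i) ->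
  (gh_dist X (simplex lambda_gt0 m) <= ((lambda - sigma) / 2)%:E)%E.
Proof.
move=> fsurj; apply: ereal_inf_lbound; exists ((lambda - sigma) / 2) => //.
pose iX (x : X) : T := inl x; pose iS (i : simplex lambda_gt0 m) : T := inr i.
exists T, (range iX), (range iS); split; [by exists iX|by exists iS|].
have crossE x : mdist (iX x) (iS (f x)) = (lambda - sigma) / 2.
  by rewrite [LHS]/(cross_dist x (f x)) /cross_dist eqxx.
rewrite /hausdorff_dist ge_max; apply/andP; split; apply: ge_ereal_sup => _ [_ [t _ <-] <-].
  apply: ge_ereal_inf; exists (mdist (iX t) (iS (f t)))%:E; last by rewrite crossE.
  by exists (iS (f t)) => //; exists (f t).
have [x <-] := fsurj t.
apply: ge_ereal_inf; exists (mdist (iX x) (iS (f x)))%:E; last by rewrite crossE.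
by exists (iX x) => //; exists x.
Qed.

End Glue.

(** * Lower bound: a close embedding yields a separated partition *)

Lemma le_gh_dist_simplex (R : realType) (X : metricType R) (lambda sigma : R)
    (lambda_gt0 : 0 < lambda) (m : nat) : 0 <= sigma ->
  (forall f : X -> simplex lambda_gt0 m, (forall i, exists x, f x = i) ->
    (forall x y, f x != f y -> sigma < mdist x y) -> False) ->
  (((lambda - sigma) / 2)%:E <= gh_dist X (simplex lambda_gt0 m))%E.
Proof.
move=> sigma_ge0 nof; apply: le_ereal_inf_tmp => _ [r [Z [A [B [[gX gXiso <-] [gS gSiso <-]]]]]] + <-.
rewrite /hausdorff_dist ge_max => /andP[/ereal_supP XS /ereal_supP SX].
rewrite lee_fin leNgt; apply/negP => rs.
(* The infima in the Hausdorff distance need not be attained, so nearby points are found only within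
   some [r'] strictly above [r]; the midpoint stays below the critical value. *)
pose r' := (r + (lambda - sigma) / 2) / 2.
have rr' : r < r' by rewrite /r'; lra.
have r's : r' < (lambda - sigma) / 2 by rewrite /r'; lra.
have Xnear x : exists i, mdist (gX x) (gS i) < r'.
  have /le_lt_trans : (ereal_inf [set (mdist (gX x) b)%:E | b in range gS] <= r%:E)%E.
    by apply: XS; exists (gX x) => //; exists x.
  have rr'E : (r%:E < r'%:E)%E by rewrite lte_fin.
  move=> /(_ _ rr'E)/ereal_inf_lt[_ [_ [i _ <-] <-]]; rewrite lte_fin => xi.
  by exists i.
have Snear i : exists x, mdist (gX x) (gS i) < r'.
  have /le_lt_trans : (ereal_inf [set (mdist a (gS i))%:E | a in range gX] <= r%:E)%E.
    by apply: SX; exists (gS i) => //; exists i.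
  have rr'E : (r%:E < r'%:E)%E by rewrite lte_fin.
  move=> /(_ _ rr'E)/ereal_inf_lt[_ [_ [x _ <-] <-]]; rewrite lte_fin => xi.
  by exists x.
have simplexE (i j : simplex lambda_gt0 m) : mdist i j = if i == j then 0 else lambda by [].
have [f fnear] := choice Xnear; apply: (nof f) => [i|x y fxy].
  (* A point near both [i] and another vertex [f x] would force [lambda < 2 * r'], whereas
     [2 * r' < lambda - sigma <= lambda]. *)
  have [x xi] := Snear i; exists x; apply/eqP/negPn/negP => fxi.
  have := metric_triangle (gS (f x)) (gX x) (gS i).
  rewrite gSiso simplexE (negbTE fxi) [mdist (gS (f x)) _]metric_sym.
  by have := fnear x; lra.
(* The chain from [f x] through [x] and [y] to [f y] has length at least [lambda], and its two outer
   links take up less than [lambda - sigma]. *)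
have := metric_triangle (gS (f x)) (gX x) (gS (f y)).
have := metric_triangle (gX x) (gX y) (gS (f y)).
rewrite gSiso gXiso simplexE (negbTE fxy) [mdist (gS (f x)) _]metric_sym.
by have := fnear x; have := fnear y; lra.
Qed.

Theorem corollary3p2 (R : realType) (X : finMetricType R)
    (G : {set {set X}}) (mstG : is_mst G)
    (lambda : R) (lambda_gt0 : 0 < lambda)
    (diam_le : (2%:E * diam X <= lambda%:E)%E)
    (k : nat) (k_bounds : (1 <= k <= #|X| - 1)%N) :
  (((spectrum G)`_k.-1)%:E =
     lambda%:E - 2%:E * gh_dist X (simplex lambda_gt0 k.+1))%E.
Proof.
(* From here on [k] is the predecessor of the given index, to match zero-based lists; the simplex
   has [k.+2] vertices. *)
case: k k_bounds => // k /= kX; set s := (spectrum G)`_k.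
have [[G2 connG _] _] := mstG.
(* Ensures that [s] is a genuine entry of the spectrum and not the default 0 of [nth]. *)
have kG : (k < #|G|)%N.
  have := connected_card connG; have : (k < #|X| - 1)%N by [].
  lia.
have mdist2 (x y : X) : mdist x y <= lambda / 2.
  have : (2%:E * (mdist x y)%:E <= lambda%:E)%E.
    apply: le_trans diam_le; rewrite lee_pmul2l//; apply: ereal_sup_ubound.
    by exists (x, y).
  by rewrite -EFinM lee_fin; lra.
have s_ge0 : 0 <= s by have [e _] := spectrum_mem kG; rewrite /s => ->; exact: edge_length_ge0.
(* As an edge length, [s] is a distance in [X]. Hence [s < lambda], and [lambda - s >= lambda / 2]
   bounds every distance in [X], as the gluing requires. *)
have s_le : s <= lambda / 2.
  have [e eG] := spectrum_mem kG; rewrite /s => ->.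
  by have /eqP/cards2P[u [v [uv ->]]] := G2 _ eG; rewrite edge_length2.
suff -> : gh_dist X (simplex lambda_gt0 k.+2) = ((lambda - s) / 2)%:E.
  by rewrite -EFinM -EFinB; congr (_%:E); lra.
apply/eqP; rewrite eq_le; apply/andP; split.
  have [f [fsurj fsep]] := mst_clustering mstG kG.
  apply: (gh_dist_simplex_le (f := f : X -> simplex lambda_gt0 k.+2)) => //.
  - by lra.
  - by move=> x y; have := mdist2 x y; lra.
by apply: le_gh_dist_simplex => // f; exact: mst_no_clustering.
Qed.
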